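(* Let $A\colon\mathbb{R}^n_+\to\mathbb{R}^n_+$ be a continuous max-preserving map with $A0=0$. Let any of the following conditions hold: (1) for every $x\in\mathbb{R}^n_+$, $A^kx\to 0$ as $k\to\infty$; (2) for every $x\in\mathbb{R}^n_+$ with $x\neq 0$, $Ax\ngeq x$ (that is, $Ax\ge x$ does not hold); (3) every cycle in the matrix $A=(a_{ij})$ is a contraction, i.e. $(a_{i_1i_2}\circ a_{i_2i_3}\circ\cdots\circ a_{i_ki_1})(t)<t$ for every $t>0$ and all finite sequences $(i_1,\ldots,i_k)\in\{1,\ldots,n\}^k$; (4) all minimal cycles in $A$ (those that do not contain shorter cycles) are contractions in the sense of (3); (5) for every $b\in\mathbb{R}^n_+$ there is a unique maximal solution $x\in\mathbb{R}^n_+$ to the inequality $x\le Ax\oplus b$. Then the function $l\colon\mathbb{R}^n_+\to\mathbb{R}_+$ given by $l(x)=\mathbf{1}^TA^*(x)$ is continuous, monotone, satisfies $l(0)=0$, as well as 1. $l(x)\to\infty$ whenever $\|x\|\to\infty$; 2. the left eigenvector inequality $l(Ax)\le l(x)$ for all $x\in\mathbb{R}^n_+$, and, moreover, $l(Ax)<l(x)$ whenever $x\neq 0$.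
   Context: $\mathbb{R}_+=[0,\infty)$ and $\mathbb{R}^n_+=[0,\infty)^n$, with the component-wise partial order: $x\le y$ iff $y-x\in\mathbb{R}^n_+$. A map $F$ is monotone if $x\le y$ implies $F(x)\le F(y)$. For $x,y\in\mathbb{R}^n$, $x\oplus y=\max\{x,y\}$ is the component-wise maximum, and $\bigoplus_k x_k$ is the component-wise supremum of a (possibly infinite) family. $\|x\|=\max_i|x_i|$. $\mathbf{1}=(1,\ldots,1)^T\in\mathbb{R}^n$ and $e_1,\ldots,e_n$ are the standard unit vectors of $\mathbb{R}^n$. A map $A\colon\mathbb{R}^n_+\to\mathbb{R}^n_+$ is max-preserving if $A(x\oplus y)=(Ax)\oplus(Ay)$ for all $x,y\in\mathbb{R}^n_+$ (it is then monotone). Its entry functions are $a_{ij}\colon\mathbb{R}_+\to\mathbb{R}_+$, $a_{ij}(t)=\big(A(te_j)\big)_i$, for $i,j=1,\ldots,n$; the map $A$ is identified with the matrix $(a_{ij})$, since $(Ax)_i=a_{i1}(x_1)\oplus\cdots\oplus a_{in}(x_n)$. A cycle is given by a finite sequence $(i_1,\ldots,i_k)$ of indices, with the associated composition $a_{i_1i_2}\circ a_{i_2i_3}\circ\cdots\circ a_{i_ki_1}$. $A^k$ denotes the $k$-fold composition of $A$ with itself, with $A^0=\mathrm{id}$. The closure of $A$ is $A^*x=\bigoplus_{k=0}^\infty A^kx$ (component-wise supremum).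
   Formalization: Condition (5) is supplemented by the requirement that x=0 be a maximal solution for b=0; without it the claim fails, e.g. for n=1 and A(t)=max(t/2, min(1,2t−1)), where (5) holds but A(1)=1, so l(A1)=l(1). *)

(* Defs.v *)
(* MathComp / MathComp-Analysis *)
From mathcomp Require Import all_boot all_order all_algebra.
From mathcomp Require Import all_classical all_reals all_analysis.

Set Implicit Arguments.
Unset Strict Implicit.
Unset Printing Implicit Defensive.

Import Order.TTheory GRing.Theory Num.Theory.
Import numFieldNormedType.Exports.

Local Open Scope classical_set_scope.
Local Open Scope ring_scope.

(* Vectors of R^n are column vectors; the norm [`|x|] and the topology that
   the library puts on ['cV[R]_n] are the max-norm and its topology.  A map
   R^n_+ -> R^n_+ is a function on ['cV[R]_n] of which only the restriction
   to [orthant R n] is ever used. *)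

Definition orthant (R : realType) (n : nat) : set 'cV[R]_n :=
  [set x | forall i, 0 <= x i 0].
Arguments orthant : clear implicits.

Definition vle (R : realType) (n : nat) (x y : 'cV[R]_n) : Prop :=
  forall i, x i 0 <= y i 0.

Definition vmax (R : realType) (n : nat) (x y : 'cV[R]_n) : 'cV[R]_n :=
  \col_i Num.max (x i 0) (y i 0).

Definition max_preserving (R : realType) (n : nat)
    (A : 'cV[R]_n -> 'cV[R]_n) : Prop :=
  forall x y, orthant R n x -> orthant R n y ->
    A (vmax x y) = vmax (A x) (A y).

Definition entry (R : realType) (n : nat) (A : 'cV[R]_n -> 'cV[R]_n)
    (i j : 'I_n) (t : R) : R :=
  A (t *: delta_mx j 0) i 0.

(* For c = [:: i_2; ...; i_k] this is the composition
   a_(i i_2) \o a_(i_2 i_3) \o ... \o a_(i_k j). *)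
Fixpoint walk_map (R : realType) (n : nat) (A : 'cV[R]_n -> 'cV[R]_n)
    (i : 'I_n) (c : seq 'I_n) (j : 'I_n) : R -> R :=
  if c is i' :: c' then entry A i i' \o walk_map A i' c' j else entry A i j.

(* The value on the empty sequence, which is not a cycle, is irrelevant. *)
Definition cycle_map (R : realType) (n : nat) (A : 'cV[R]_n -> 'cV[R]_n)
    (c : seq 'I_n) : R -> R :=
  if c is i :: c' then walk_map A i c' i else id.

Definition contraction (R : realType) (f : R -> R) : Prop :=
  forall t, 0 < t -> f t < t.

(* The cycle c, viewed as the closed walk i_1 -> i_2 -> ... -> i_k -> i_1,
   contains the cycle d when d is a closed segment of it: up to rotation,
   c = d ++ e, and the step of c that leaves the last index of d returns to the
   first index of d (the next index visited by c is the head of [e ++ d]). *)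
Definition cycle_contains (n : nat) (c d : seq 'I_n) : Prop :=
  exists (r : nat) (e : seq 'I_n), rot r c = d ++ e /\ ohead (e ++ d) = ohead d.

Definition minimal_cycle (n : nat) (c : seq 'I_n) : Prop :=
  c <> [::] /\
  forall d : seq 'I_n, d <> [::] -> cycle_contains c d -> ~ (size d < size c)%N.

Definition solution (R : realType) (n : nat) (A : 'cV[R]_n -> 'cV[R]_n)
    (b x : 'cV[R]_n) : Prop :=
  orthant R n x /\ vle x (vmax (A x) b).

Definition maximal_solution (R : realType) (n : nat)
    (A : 'cV[R]_n -> 'cV[R]_n) (b x : 'cV[R]_n) : Prop :=
  solution A b x /\ forall y, solution A b y -> vle x y -> y = x.

Section Conditions.
Variables (R : realType) (n : nat) (A : 'cV[R]_n -> 'cV[R]_n).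

Definition attractive : Prop :=
  forall x, orthant R n x -> iter k A x @[k --> \oo] --> (0 : 'cV[R]_n).

Definition no_increase : Prop :=
  forall x, orthant R n x -> x <> 0 -> ~ vle x (A x).

Definition cycles_contract : Prop :=
  forall c : seq 'I_n, c <> [::] -> contraction (cycle_map A c).

Definition minimal_cycles_contract : Prop :=
  forall c : seq 'I_n, minimal_cycle c -> contraction (cycle_map A c).

(* By itself this does not exclude fixed points x != 0 of A: for n = 1 and
   A t = max (t / 2) (min 1 (2 * t - 1)), whose fixed points are 0 and 1, the
   greatest solution of t <= max (A t) b is max 1 b for every b >= 0.  The
   theorem therefore uses it together with [maximal_solution A 0 0]. *)
Definition unique_maximal_solutions : Prop :=
  forall b, orthant R n b -> exists! x, maximal_solution A b x.

End Conditions.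

(* The supremum is taken in the extended reals, so it always exists. *)
Definition kleene_closure (R : realType) (n : nat)
    (A : 'cV[R]_n -> 'cV[R]_n) (x : 'cV[R]_n) (i : 'I_n) : \bar R :=
  ereal_sup (range (fun k : nat => ((iter k A x) i 0)%:E)).

(* 1^T A^* x; meaningful when all components of A^* x are finite. *)
Definition closure_sum (R : realType) (n : nat)
    (A : 'cV[R]_n -> 'cV[R]_n) (x : 'cV[R]_n) : R :=
  \sum_(i < n) fine (kleene_closure A x i).

(* Main.v *)
Require Import Defs.
From mathcomp Require Import all_boot all_order all_algebra.
From mathcomp Require Import all_classical all_reals all_analysis.
Import Order.TTheory GRing.Theory Num.Theory.
Import numFieldNormedType.Exports.
Local Open Scope classical_set_scope.
Local Open Scope ring_scope.

(** All the conditions imply [no_increase], that is, no nonzero [x] of the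
    orthant satisfies [x <= A x], and everything follows from it.

    If [x <= A x], then the iterates of [A] at [x] stay above [x]; so an
    attractive map has no nonzero such [x].  To use the contractive cycles,
    choose for each index [k] an index [f k] with
    [x k <= a_(k, f k) (x (f k))], which [x <= A x] allows; starting at an index
    where [x] is positive and iterating [f], one ends on a cycle without
    repeated index, and the composition along this cycle maps some [t > 0] to
    a value [>= t] ([minimal_cycles_no_increase]).  Finally, to say that the
    solution 0 is maximal for [b = 0] is to say that [x <= A x] only for
    [x = 0].

    Under [no_increase] the closure is a finite maximum,
    [A^* x = max_(m < n) A^m x].  Indeed, suppose that the [i]-th component of
    the iterates of [A] at [x] exceeds at time [m] all of its earlier values.
    Since [(A y)_i = max_j a_ij (y_j)], some component [j] does so at time
    [m - 1], and so on down to time 0.  If [m >= n], two of these [m + 1]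
    components coincide, and the values met between the two times [p < q] form
    a nonzero vector [z] with [z <= A z], the loop being closed by the record
    value at time [q] being larger than the value at time [p]
    ([record_lt_dim]).

    As a finite maximum of continuous monotone maps vanishing at 0, the closure
    is finite, continuous, monotone and vanishes at 0.  It dominates the
    identity, so that the sum of its components is at least the norm.  The
    iterates at [A x] are among those at [x], whence [A^* (A x) <= A^* x];
    equality of the sums would force [A^* x = A^* (A x) <= A (A^* x)], which
    contradicts [no_increase] at [A^* x] unless [x = 0]
    ([closure_map_lt]). *)

(** * Entries and iterates of a max-preserving map *)

Lemma nat_ord_repeat (n m : nat) (w : nat -> 'I_n) :
  (n <= m)%N -> exists p q, [/\ (p < q)%N, (q <= m)%N & w p = w q].
Proof.
move=> nm; have /injectivePn[a [b neab eqab]] :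
    ~~ injectiveb (fun a : 'I_m.+1 => w a).
  by apply/negP => /injectiveP/leq_card; rewrite !card_ord ltnNge nm.
wlog ab : a b neab eqab / (a < b)%N.
  move=> H; have := neab; rewrite -val_eqE neq_ltn => /orP[ab|ba].
    exact: (H a b).
  by apply: (H b a) => //; rewrite eq_sym.
by exists a, b; split=> //; rewrite -ltnS.
Qed.

Section MaxPreservingMaps.
Variables (R : realType) (n : nat) (A : 'cV[R]_n -> 'cV[R]_n).
Hypotheses (A_orthant : forall x, orthant R n x -> orthant R n (A x))
  (A_max : max_preserving A) (A0 : A 0 = 0).
Implicit Types (x y : 'cV[R]_n) (i j : 'I_n).

Lemma orthant0 : orthant R n 0.
Proof. by move=> i; rewrite mxE. Qed.

Lemma orthant_delta j (t : R) : 0 <= t -> orthant R n (t *: delta_mx j 0).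
Proof. by move=> t0 i; rewrite !mxE mulr_ge0. Qed.

Lemma vmax_r x y : vle x y -> vmax x y = y.
Proof. by move=> xy; apply/colP => i; rewrite mxE max_r. Qed.

Lemma max_preserving_monotone x y :
  orthant R n x -> orthant R n y -> vle x y -> vle (A x) (A y).
Proof.
by move=> ox oy xy i; rewrite -(vmax_r _ _ xy) A_max// mxE le_max lexx.
Qed.

Lemma iter_orthant k x : orthant R n x -> orthant R n (iter k A x).
Proof. by move=> ox; elim: k => //= k; apply: A_orthant. Qed.

Lemma iter_monotone k x y :
  orthant R n x -> orthant R n y -> vle x y -> vle (iter k A x) (iter k A y).
Proof.
move=> ox oy xy; elim: k => //= k IH.
by apply: max_preserving_monotone => //; apply: iter_orthant.
Qed.

Lemma iter_fix0 k : iter k A 0 = 0.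
Proof. by elim: k => //= k ->. Qed.

Lemma entry_ge0 i j (t : R) : 0 <= t -> 0 <= entry A i j t.
Proof. by move=> t0; apply: A_orthant; apply: orthant_delta. Qed.

Lemma entry_monotone i j (s t : R) :
  0 <= s -> s <= t -> entry A i j s <= entry A i j t.
Proof.
move=> s0 st; have t0 := le_trans s0 st.
apply: max_preserving_monotone; try exact: orthant_delta.
by move=> k; rewrite !mxE ler_wpM2r.
Qed.

Lemma entry_le i j x : orthant R n x -> entry A i j (x j 0) <= A x i 0.
Proof.
move=> ox; apply: max_preserving_monotone => //; first exact: orthant_delta.
move=> k; rewrite !mxE eqxx andbT; case: eqP => [->|_]; first by rewrite mulr1.
by rewrite mulr0.
Qed.

(** Together with [entry_le] this is [(A x)_i = max_j a_ij (x_j)].  The vector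
    [x] is the maximum of its coordinate vectors, which the induction adds one
    at a time, and [A] preserves each of these maxima. *)
Lemma entry_attained x i :
  orthant R n x -> exists j, A x i 0 <= entry A i j (x j 0).
Proof.
move=> ox; pose trunc (s : seq 'I_n) := \col_k (if k \in s then x k 0 else 0).
have o_trunc s : orthant R n (trunc s) by move=> k; rewrite mxE; case: ifP.
suff H s : exists j, A (trunc s) i 0 <= entry A i j (x j 0).
  have [j] := H (enum 'I_n); have -> : trunc (enum 'I_n) = x.
    by apply/colP => k; rewrite mxE mem_enum.
  by exists j.
elim: s => [|a s [j IH]].
  (* [trunc [::]] is 0, so any index can serve as [j]. *)
  exists i; have -> : trunc [::] = 0 by apply/colP => k; rewrite !mxE.
  by rewrite A0 mxE entry_ge0.
have -> : trunc (a :: s) = vmax (x a 0 *: delta_mx a 0) (trunc s).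
  apply/colP => k; rewrite !mxE inE eqxx andbT.
  case: eqP => [->|_] /=; rewrite ?mulr1 ?mulr0; case: ifP => _;
    by rewrite ?maxxx ?(max_l (ox _)) ?(max_r (ox _)).
rewrite A_max//; last exact: orthant_delta.
rewrite mxE; case: (leP (A (x a 0 *: delta_mx a 0) i 0) (A (trunc s) i 0)) => _.
  by exists j.
by exists a.
Qed.

(** * From each condition to the absence of increasing vectors *)

Lemma attractive_no_increase : attractive A -> no_increase A.
Proof.
move=> attr x ox xn0 xA; apply: xn0.
have x_le k : vle x (iter k A x).
  elim: k => [|k IH] i //=; apply: le_trans (xA i) _.
  by apply: max_preserving_monotone => //; apply: iter_orthant.
apply/colP => i; rewrite mxE; apply/eqP; rewrite eq_le ox andbT.
have Ak0 : (iter k A x) i 0 @[k --> \oo] --> (0 : 'cV[R]_n) i 0.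
  exact: (cvg_comp _ _ (attr x ox) (@coord_continuous R n 1 i 0 0)).
rewrite mxE in Ak0.
by apply: (cvgr_to_ge Ak0); apply: nearW => k; exact: x_le.
Qed.

Lemma maximal_solution0_no_increase :
  maximal_solution A 0 0 -> no_increase A.
Proof.
move=> [_ max0] x ox xn0 xA; apply: xn0; apply: max0; last first.
  by move=> i; rewrite mxE.
by split=> // i; rewrite mxE le_max xA.
Qed.

(** A shorter cycle contained in [c] returns to its first index before [c] does,
    so this index would occur twice in [c]. *)
Lemma uniq_minimal_cycle (c : seq 'I_n) :
  c <> [::] -> uniq c -> minimal_cycle c.
Proof.
move=> cn0 uc; split=> // -[//|h d] _ [r [e [rot_c head_e]]] ltd.
case: e rot_c head_e => [|a e] rot_c.
  by move: ltd; rewrite -(size_rot r c) rot_c cats0 ltnn.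
case=> ah; move: uc; rewrite -(rot_uniq r) rot_c ah cat_uniq /=.
by rewrite inE eqxx andbF.
Qed.

(** When [f] selects for every index an entry that realizes [x <= A x], the
    inequality propagates along the orbits of [f]. *)
Lemma walk_map_ge x (f : 'I_n -> 'I_n) i c j :
    orthant R n x -> (forall k, x k 0 <= entry A k (f k) (x (f k) 0)) ->
  fpath f i (rcons c j) -> x i 0 <= walk_map A i c j (x j 0).
Proof.
move=> ox xf; elim: c i => [|i' c IH] i /= /andP[/eqP fi].
  by move=> _; rewrite -fi.
move=> /IH le_i'; apply: le_trans (xf i) _; rewrite fi.
exact: entry_monotone.
Qed.

(** If [x <= A x], let [f] select for every index an entry that realizes this
    inequality.  The orbit of a periodic point [j] of [f] is a cycle without
    repeated index, hence a minimal one, and it maps [x j] to a value [>= x j].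
    Here [x j] is positive if the iteration of [f] starts where [x] is positive:
    since [A 0 = 0], positivity propagates along [f]. *)
Lemma minimal_cycles_no_increase :
  minimal_cycles_contract A -> no_increase A.
Proof.
move=> mc x ox xn0 xA.
have [f xf] : {f : 'I_n -> 'I_n &
    forall k, x k 0 <= entry A k (f k) (x (f k) 0)}.
  apply: (@choice _ _ (fun k j => x k 0 <= entry A k j (x j 0))) => k.
  have [j Aj] := entry_attained x k ox.
  by exists j; exact: le_trans (xA k) Aj.
have [i xi] : exists i, 0 < x i 0.
  apply/not_existsP => npos; apply: xn0; apply/colP => i.
  apply/eqP; rewrite mxE eq_le ox andbT leNgt; exact/negP.
have pos k : 0 < x (iter k f i) 0.
  elim: k => //= k xk; rewrite ltNge; apply/negP => le0.
  have x0 : x (f (iter k f i)) 0 = 0 by apply/eqP; rewrite eq_le ox le0.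
  by have := lt_le_trans xk (xf _); rewrite x0 /entry scale0r A0 mxE ltxx.
have [k [p kp]] : exists k p, iter p.+1 f (iter k f i) = iter k f i.
  have [a [b [ab _ eqab]]] :=
    nat_ord_repeat n n (fun k => iter k f i) (leqnn n).
  by exists a, (b - a).-1; rewrite -iterD prednK ?subn_gt0// subnK// ltnW.
set j := iter k f i in kp.
have cyc : fcycle f (orbit f j).
  by apply/(orbitPcycle 3 0); exists p.
have [c oc] : exists c, orbit f j = j :: c.
  by rewrite /orbit -orderSpred /=; eexists.
have := mc (orbit f j) _ (x j 0) (pos k); rewrite ltNge => /(_ _)/negP; apply.
  by apply: uniq_minimal_cycle; [rewrite oc | exact: orbit_uniq].
by rewrite oc /= in cyc *; exact: walk_map_ge xf cyc.
Qed.

(** * Finiteness of the closure in the absence of increasing vectors *)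

Section NoIncrease.
Hypothesis no_inc : no_increase A.

Definition record x m i :=
  forall k, (k < m)%N -> (iter k A x) i 0 < (iter m A x) i 0.

(** If [j] had already reached at a time [k < m] its value at time [m], then
    applying [a_ij] would show that [i] reached at time [k + 1] its value at
    time [m + 1]. *)
Lemma record_pred x m i : orthant R n x -> record x m.+1 i ->
  exists j, record x m j /\
    (iter m.+1 A x) i 0 <= entry A i j ((iter m A x) j 0).
Proof.
move=> ox rec; have [j Aj] := entry_attained _ i (iter_orthant m x ox).
exists j; split=> // k km; rewrite ltNge; apply/negP => le_mk.
have := rec k.+1 km; rewrite ltNge => /negP; apply; apply: le_trans Aj _.
apply: (@le_trans _ _ (entry A i j ((iter k A x) j 0))).
  by apply: entry_monotone => //; apply: iter_orthant.
by apply: entry_le; apply: iter_orthant.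
Qed.

(** The walk is indexed by time, so its last index [w m] is [i] and its steps go
    backwards along the entries of [A]. *)
Lemma record_walk x m i : orthant R n x -> record x m i ->
  exists w : nat -> 'I_n, [/\ w m = i,
    forall p, (p <= m)%N -> record x p (w p) &
    forall p, (p < m)%N ->
      (iter p.+1 A x) (w p.+1) 0 <=
      entry A (w p.+1) (w p) ((iter p A x) (w p) 0)].
Proof.
move=> ox; elim: m i => [|m IH] i rec.
  by exists (fun=> i); split=> // p; rewrite leqn0 => /eqP->.
have [j [recj Aj]] := record_pred _ _ _ ox rec.
have [w [wm wrec wA]] := IH j recj.
exists (fun p => if (p <= m)%N then w p else i); split.
- by rewrite ltnn.
- move=> p; rewrite leq_eqVlt => /orP[/eqP->|]; first by rewrite ltnn.
  by rewrite ltnS => pm; rewrite pm; exact: wrec.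
- move=> p; rewrite ltnS => pm; rewrite pm; case: ltnP => [ltpm|mp].
    exact: wA.
  have -> : p = m by apply/eqP; rewrite eqn_leq pm.
  by rewrite wm.
Qed.

(** A walk of records of length at least [n] visits some index at two times
    [p < q]; the values that it meets in between support a vector [z <= A z]. *)
Lemma record_lt_dim x m i : orthant R n x -> record x m i -> (m < n)%N.
Proof.
move=> ox rec; rewrite ltnNge; apply/negP => nm.
have [w [_ wrec wA]] := record_walk _ _ _ ox rec.
have [p [q [pq qm wpq]]] := nat_ord_repeat n m w nm.
have it0 k j : 0 <= (iter k A x) j 0 by apply: iter_orthant.
(* The walk may visit an index several times between [p] and [q], whence the
   maximum.  Time [p] is left out: its index is that of time [q], where the
   value is larger. *)
pose z := \col_j \big[Num.max/0]_(r < q.+1 | (p < r)%N && (w r == j))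
                   (iter r A x) j 0 : 'cV[R]_n.
have oz : orthant R n z by move=> j; rewrite mxE; exact: bigmax_ge_id.
have z_ge r : (p < r)%N -> (r <= q)%N -> (iter r A x) (w r) 0 <= z (w r) 0.
  move=> pr rq; rewrite mxE.
  by apply: (bigmax_sup (Ordinal (rq : (r < q.+1)%N))) => /=; rewrite ?pr ?eqxx.
have pq_lt : (iter p A x) (w p) 0 < (iter q A x) (w q) 0.
  by rewrite wpq; apply: wrec.
apply: (no_inc z oz).
  move=> z0; have := z_ge q pq (leqnn _); rewrite z0 mxE leNgt => /negP; apply.
  exact: le_lt_trans pq_lt.
move=> j; rewrite {1}/z mxE; apply/bigmax_leP; split; first exact: A_orthant.
case=> -[//|r] /= rq /andP[pr /eqP<-].
apply: le_trans (wA r (leq_trans (rq : (r < q)%N) qm)) _.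
apply: le_trans (entry_le _ (w r) _ oz).
apply: entry_monotone => //.
(* For [r = p] the value at time [p] is not in [z], but [w p = w q] and the
   value at time [q] is larger. *)
move: pr; rewrite ltnS leq_eqVlt => /orP[/eqP<-|pr]; last first.
  by apply: z_ge => //; apply: ltnW.
by apply: le_trans (ltW pq_lt) _; rewrite wpq; exact: z_ge.
Qed.

(** The base value 0 of the maximum is harmless on the orthant, where the
    iterates are nonnegative. *)
Definition finite_closure x : 'cV[R]_n :=
  \col_i \big[Num.max/0]_(m < n) (iter m A x) i 0.

(** A value that is not a record is dominated by an earlier one, so strong
    induction on the time leads back to times smaller than [n]. *)
Lemma iter_le_closure x k :
  orthant R n x -> vle (iter k A x) (finite_closure x).
Proof.
move=> ox; elim/ltn_ind: k => k IH i.
have [kn|nk] := ltnP k n.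
  by rewrite mxE; exact: (bigmax_sup (Ordinal kn)).
have /existsNP[m /not_implyP[mk /negP]] : ~ record x k i.
  by move=> /(record_lt_dim _ _ _ ox); rewrite ltnNge nk.
by rewrite -leNgt => le_km; apply: le_trans le_km _; exact: IH.
Qed.

Lemma kleene_closureE x i :
  orthant R n x -> kleene_closure A x i = (finite_closure x i 0)%:E.
Proof.
move=> ox; apply/eqP; rewrite eq_le; apply/andP; split.
  by apply: ge_ereal_sup => _ [k _ <-]; rewrite lee_fin iter_le_closure.
have it_le k : ((iter k A x i 0)%:E <= kleene_closure A x i)%E.
  by apply: ereal_sup_ubound; exists k.
rewrite mxE; elim/big_rec: _ => [|m y _ IH].
  by apply: le_trans (it_le 0); rewrite lee_fin.
by rewrite EFin_max ge_max it_le IH.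
Qed.

Lemma closure_sumE x :
  orthant R n x -> closure_sum A x = \sum_i finite_closure x i 0.
Proof. by move=> ox; apply: eq_bigr => i _; rewrite kleene_closureE. Qed.

Lemma orthant_closure x : orthant R n (finite_closure x).
Proof. by move=> i; rewrite mxE; exact: bigmax_ge_id. Qed.

Lemma le_closure x : orthant R n x -> vle x (finite_closure x).
Proof. exact: (iter_le_closure x 0). Qed.

Lemma closure_monotone x y :
  orthant R n x -> orthant R n y -> vle x y ->
  vle (finite_closure x) (finite_closure y).
Proof.
move=> ox oy xy i; rewrite !mxE.
by apply: le_bigmax2 => m _; apply: iter_monotone.
Qed.

Lemma closure_map_le x :
  orthant R n x -> vle (finite_closure (A x)) (finite_closure x).
Proof.
move=> ox i; rewrite mxE; apply/bigmax_leP.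
split=> [|m _]; first exact: orthant_closure.
by rewrite -iterSr; exact: iter_le_closure.
Qed.

Lemma closure_map_le_map x :
  orthant R n x -> vle (finite_closure (A x)) (A (finite_closure x)).
Proof.
move=> ox i; rewrite mxE; apply/bigmax_leP.
split=> [|m _]; first by apply: A_orthant; exact: orthant_closure.
rewrite -iterSr /=; apply: max_preserving_monotone => //.
- exact: iter_orthant.
- exact: orthant_closure.
- exact: iter_le_closure.
Qed.

(** Otherwise [A^* x <= A^* (A x) <= A (A^* x)], so that [A^* x], and with it
    [x], is 0. *)
Lemma closure_map_lt x :
  orthant R n x -> x <> 0 ->
  exists i, finite_closure (A x) i 0 < finite_closure x i 0.
Proof.
move=> ox xn0; apply/not_existsP => nlt.
apply: (no_inc _ (orthant_closure x)) => [c0|i].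
  apply: xn0; apply/colP => i; apply/eqP.
  by rewrite eq_le mxE ox andbT; have := le_closure x ox i; rewrite c0 mxE.
apply: le_trans (closure_map_le_map x ox i).
by rewrite leNgt; exact/negP.
Qed.

End NoIncrease.

(** * Continuity of the closure *)

Section Continuity.
Hypothesis A_cont : {within orthant R n, continuous A}.

(** Continuity of [A] is only assumed within the orthant, so iterating it
    requires convergence to be relative to the orthant in the target too. *)
Lemma iter_cvg_within k x : orthant R n x ->
  iter k A y @[y --> within (orthant R n) (nbhs x)] -->
  within (orthant R n) (nbhs (iter k A x)).
Proof.
move=> ox; elim: k => [|k IH]; first exact: cvg_id.
have /subspace_continuousP/(_ _ (iter_orthant k x ox)) Ak := A_cont.
have Akw : A y @[y --> within (orthant R n) (nbhs (iter k A x))] -->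
    within (orthant R n) (nbhs (iter k.+1 A x)).
  move=> U /= /Ak; rewrite /within /nbhs /= => HU.
  by apply: filterS HU => y Hy oy; apply: Hy => //; exact: A_orthant.
exact: cvg_comp IH Akw.
Qed.

Lemma closure_continuous i :
  {within orthant R n, continuous (fun x => finite_closure x i 0)}.
Proof.
apply/subspace_continuousP => x ox.
rewrite [X in _ --> X]mxE.
have -> : (fun y : 'cV[R]_n => finite_closure y i 0) =
    fun y => \big[Num.max/0]_(m < n) (iter m A y) i 0.
  by apply/funext => y; rewrite mxE.
apply: cvg_big => [|m _]; first exact: max_continuous.
have iter_cvg : iter m A y @[y --> within (orthant R n) (nbhs x)] -->
    iter m A x by exact: cvg_trans (iter_cvg_within m x ox) (cvg_within _).
exact: (cvg_comp _ _ iter_cvg (@coord_continuous R n 1 i 0 (iter m A x))).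
Qed.

End Continuity.
End MaxPreservingMaps.

(** * Properties of the sum of the closure *)

Theorem theorem2 (R : realType) (n : nat) (A : 'cV[R]_n -> 'cV[R]_n)
  (A_orthant : forall x, orthant R n x -> orthant R n (A x))
  (A_continuous : {within orthant R n, continuous A})
  (A_max : max_preserving A)
  (A0 : A 0 = 0)
  (A_cond : attractive A \/
            no_increase A \/
            cycles_contract A \/
            minimal_cycles_contract A \/
            (unique_maximal_solutions A /\ maximal_solution A 0 0)) :
  (forall x, orthant R n x -> forall i, kleene_closure A x i \is a fin_num) /\
  (forall x, orthant R n x -> 0 <= closure_sum A x) /\
  {within orthant R n, continuous (closure_sum A)} /\
  (forall x y, orthant R n x -> orthant R n y -> vle x y ->
     closure_sum A x <= closure_sum A y) /\
  closure_sum A 0 = 0 /\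
  (forall M : R, exists K : R, forall x, orthant R n x -> K < `|x| ->
     M < closure_sum A x) /\
  (forall x, orthant R n x -> closure_sum A (A x) <= closure_sum A x) /\
  (forall x, orthant R n x -> x <> 0 -> closure_sum A (A x) < closure_sum A x).
Proof.
have no_inc : no_increase A.
  case: A_cond => [|[//|[|[|[_]]]]].
  - exact: attractive_no_increase.
  - move=> cc; apply: minimal_cycles_no_increase => // c [cn0 _]; exact: cc.
  - exact: minimal_cycles_no_increase.
  - exact: maximal_solution0_no_increase.
have sumE := closure_sumE _ _ _ A_orthant A_max A0 no_inc.
split; first by move=> x ox i; rewrite kleene_closureE.
split.
  move=> x ox; rewrite sumE//.
  by apply: sumr_ge0 => i _; exact: orthant_closure.
split.
  apply/subspace_continuousP => x ox; rewrite /from_subspace sumE//.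
  have near_sum : {near within (orthant R n) (nbhs x),
      (fun y => \sum_i finite_closure R n A y i 0) =1 closure_sum A}.
    by rewrite near_withinE; apply: nearW => y oy; rewrite sumE.
  apply: cvg_trans (near_eq_cvg near_sum) _.
  apply: cvg_big => [|i _]; first exact: add_continuous.
  have := closure_continuous _ _ _ A_orthant A_continuous i.
  by move=> /subspace_continuousP; exact.
split.
  move=> x y ox oy xy; rewrite !sumE//.
  by apply: ler_sum => i _; exact: closure_monotone.
split.
  rewrite sumE; last exact: orthant0.
  apply: big1 => i _; rewrite mxE.
  apply: big1_idem => [|m _]; first exact: maxxx.
  by rewrite iter_fix0// mxE.
split.
  move=> M; exists M => x ox Mx; apply: lt_le_trans Mx _; rewrite sumE//.
  have sum0 : 0 <= \sum_i finite_closure R n A x i 0.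
    by apply: sumr_ge0 => i _; exact: orthant_closure.
  rewrite [`|x|]mx_normrE; apply/bigmax_leP; split=> // -[i j] _ /=.
  rewrite ord1 ger0_norm; last exact: ox.
  apply: le_trans (le_closure _ _ _ A_orthant A_max A0 no_inc x ox i) _.
  by rewrite (bigD1 i)//= lerDl; apply: sumr_ge0 => k _; exact: orthant_closure.
split.
  move=> x ox; rewrite !sumE//; last exact: A_orthant.
  by apply: ler_sum => i _; exact: closure_map_le.
move=> x ox xn0; rewrite !sumE//; last exact: A_orthant.
have [i lti] := closure_map_lt _ _ _ A_orthant A_max A0 no_inc x ox xn0.
rewrite (bigD1 i)//= [ltRHS](bigD1 i)//=; apply: ltr_leD => //.
by apply: ler_sum => k _; exact: closure_map_le.
Qed.
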